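(* Let $E$ be a real or complex Banach lattice which is monotonically complete and has the Fatou property. Let $T = (T_i)_{i \in I}$ be a family of positive and contractive (i.e., $\|T_i\| \le 1$) linear operators on $E$ which mutually commute. Then the fixed space $$F := \operatorname{fix} T := \{x \in E : T_i x = x \text{ for all } i \in I\}$$ of $T$ is a closed vector subspace of $E$ with the following properties: (a) The space $F$ is a lattice subspace of $E$. (b) The space $F$ is a Banach lattice with respect to the norm induced by $E$ (and the order inherited from $E$). (c) The Banach lattice $F$ is monotonically complete and has the Fatou property. In particular, $F$ is Dedekind complete. (d) Let $G \subseteq F$ be a set of real vectors which has a supremum $g_E$ in $E$. Then $G$ also has a supremum $g_F$ in $F$, and $g_E \le g_F$. If $g_E \ge 0$, then $\|g_F\| = \|g_E\|$.
   Context: A complex Banach lattice $E$ is the Banach lattice complexification of a real Banach lattice $E_{\mathbb{R}}$, called the real part of $E$; a real Banach lattice is regarded as its own real part. A vector of $E$ is called real if it lies in the real part of $E$. The order on $E$ is that of its real part, $E_+$ denotes the positive cone, and suprema in $E$ of sets (or nets) of real vectors are taken in the real part of $E$. A linear operator on $E$ is positive if it maps $E_+$ into $E_+$. Fatou property: $E$ has the Fatou property if every increasing net $(x_j)_{j\in J} \subseteq E_+$ which possesses a supremum $x \in E$ satisfies $\|x\| = \sup_{j \in J} \|x_j\|$. Monotonically complete: $E$ is monotonically complete if every norm bounded increasing net in $E_+$ has a supremum in $E$ (equivalently, every norm bounded increasing net in the real part of $E$ has a supremum). Dedekind complete: every non-empty order bounded set (of real vectors) has a supremum. Lattice subspace: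 if $E$ is a real Banach lattice, a vector subspace $F \subseteq E$ is a lattice subspace of $E$ if it is, with respect to the order inherited from $E$, a vector lattice in its own right (possibly with lattice operations different from those of $E$). If $E$ is a complex Banach lattice, a vector subspace $F \subseteq E$ is a lattice subspace of $E$ if it is invariant under complex conjugation and its real part $F_{\mathbb{R}} := F \cap E_{\mathbb{R}}$ is a lattice subspace of $E_{\mathbb{R}}$. Suprema in $F$ of sets of real vectors are taken in the real part of $F$ with the inherited order. In the complex case, the assertion that $F$ is a Banach lattice with respect to the norm induced by $E$ means that the real part $F_{\mathbb{R}}$ is a real Banach lattice with respect to the inherited order and norm, and that the norm induced by $E$ on $F$ coincides with the Banach lattice complexification norm, i.e. $\|f\| = \|\,|f|_F\,\|$ for all $f = f_1 + i f_2 \in F$ with $f_1, f_2 \in F_{\mathbb{R}}$, where $|f|_F$ is the supremum in $F$ of $\{f_1\cos\theta + f_2 \sin\theta : \theta \in [0,2\pi)\}$. *)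

(* Defs.v *)
From HB Require Import structures.
From mathcomp Require Import all_boot all_order all_algebra.
From mathcomp Require Import all_classical all_reals all_analysis.
From mathcomp Require Import complex.

Set Implicit Arguments.
Unset Strict Implicit.
Unset Printing Implicit Defensive.

Import Order.TTheory GRing.Theory Num.Theory.
Import numFieldNormedType.Exports.

Local Open Scope classical_set_scope.
Local Open Scope ring_scope.

(* Norms take values in the scalar field [K]; when [K] is [R[i]], [a <= b] in
   [K] means that [b - a] is a nonnegative real. The order of the real part [V]
   of a space is a relation [le] on the whole space that is only ever constrained
   and used on [V]; a subspace inherits it by keeping the same [le]. *)
Section RealPart.
Context {K : numFieldType} {E : completeNormedModType K}.
Variable le : E -> E -> Prop.
Implicit Types V A : set E.

Local Notation "x <<= y" := (le x y) (at level 70, no associativity).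

Definition real_subspace V : Prop :=
  [/\ V 0,
      forall x y, V x -> V y -> V (x + y) &
      forall (a : K) x, a \is Num.real -> V x -> V (a *: x)].

Definition linear_subspace V : Prop :=
  [/\ V 0,
      forall x y, V x -> V y -> V (x + y) &
      forall (a : K) x, V x -> V (a *: x)].

Definition is_ubound A (u : E) : Prop := forall x, A x -> x <<= u.
Definition is_lbound A (l : E) : Prop := forall x, A x -> l <<= x.

(* Suprema and infima are relative to [V]: only bounds lying in [V] compete. *)
Definition is_sup_in V A (s : E) : Prop :=
  [/\ V s, is_ubound A s & forall u, V u -> is_ubound A u -> s <<= u].

Definition is_inf_in V A (s : E) : Prop :=
  [/\ V s, is_lbound A s & forall l, V l -> is_lbound A l -> l <<= s].

Definition positive_cone V : set E := [set x | V x /\ 0 <<= x].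

Definition partial_order_on V : Prop :=
  [/\ forall x, V x -> x <<= x,
      forall x y, V x -> V y -> x <<= y -> y <<= x -> x = y &
      forall x y z, V x -> V y -> V z -> x <<= y -> y <<= z -> x <<= z].

Definition ordered_vector_space V : Prop :=
  [/\ real_subspace V,
      partial_order_on V,
      forall x y z, V x -> V y -> V z -> x <<= y -> x + z <<= y + z &
      forall (a : K) x y, 0 <= a -> V x -> V y -> x <<= y -> a *: x <<= a *: y].

Definition vector_lattice V : Prop :=
  [/\ ordered_vector_space V,
      forall x y, V x -> V y -> exists s, is_sup_in V [set x; y] s &
      forall x y, V x -> V y -> exists s, is_inf_in V [set x; y] s].

Definition is_abs_in V (x u : E) : Prop := is_sup_in V [set x; - x] u.

Definition lattice_norm V : Prop :=
  forall x y u v, V x -> V y -> is_abs_in V x u -> is_abs_in V y v ->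
    u <<= v -> `|x| <= `|y|.

Definition norm_complete V : Prop :=
  forall F : set_system E, ProperFilter F -> F V -> cauchy F ->
    exists2 l, V l & F --> l.

Definition real_banach_lattice V : Prop :=
  [/\ vector_lattice V, lattice_norm V & norm_complete V].

Definition directed_preorder (J : Type) (leJ : J -> J -> Prop) : Prop :=
  [/\ inhabited J,
      forall i, leJ i i,
      forall i j k, leJ i j -> leJ j k -> leJ i k &
      forall i j, exists k, leJ i k /\ leJ j k].

Definition increasing_net (J : Type) (leJ : J -> J -> Prop) (x : J -> E) : Prop :=
  directed_preorder leJ /\ forall i j, leJ i j -> x i <<= x j.

Definition fatou_property V : Prop :=
  forall (J : Type) (leJ : J -> J -> Prop) (x : J -> E) (s : E),
    increasing_net leJ x -> (forall j, positive_cone V (x j)) ->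
    is_sup_in V (range x) s ->
    supremums (range (fun j => `|x j|)) `|s|.

Definition monotonically_complete V : Prop :=
  forall (J : Type) (leJ : J -> J -> Prop) (x : J -> E),
    increasing_net leJ x -> (forall j, positive_cone V (x j)) ->
    (exists M : K, forall j, `|x j| <= M) ->
    exists s, is_sup_in V (range x) s.

Definition dedekind_complete V : Prop :=
  forall A : set E, A `<=` V -> A !=set0 ->
    (exists2 l, V l & is_lbound A l) -> (exists2 u, V u & is_ubound A u) ->
    exists s, is_sup_in V A s.

Definition positive_operator V (T : E -> E) : Prop :=
  forall x, positive_cone V x -> positive_cone V (T x).

Definition contractive (T : E -> E) : Prop := forall x, `|T x| <= `|x|.

Definition fixed_space (I : Type) (T : I -> E -> E) : set E :=
  [set x | forall i, T i x = x].

End RealPart.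

Section Complexification.
Context {R : realType} {E : completeNormedModType R[i]}.
Variable le : E -> E -> Prop.

(* [W] is the complexification of [V]: W is the direct sum of V and iV, and the
   norm of x + iy is that of its modulus, the supremum in [V] of the vectors
   (cos t) x + (sin t) y. *)
Definition complexification (W V : set E) : Prop :=
  [/\ W = [set x + 'i%C *: y | x in V & y in V],
      forall x y, V x -> V y -> x + 'i%C *: y = 0 -> x = 0 /\ y = 0 &
      forall x y, V x -> V y ->
        exists2 m : E,
          is_sup_in le V [set (cos t)%:C%C *: x + (sin t)%:C%C *: y
                         | t in [set t : R | 0 <= t < 2 * pi]] m &
          `|x + 'i%C *: y| = `|m|].

Definition conjugation_invariant (V F : set E) : Prop :=
  forall x y, V x -> V y -> F (x + 'i%C *: y) -> F (x - 'i%C *: y).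

End Complexification.

Variant scalar_kind := RealScalars | ComplexScalars.

Definition scalars (R : realType) (k : scalar_kind) : numFieldType :=
  match k with
  | RealScalars => R : numFieldType
  | ComplexScalars => R[i] : numFieldType
  end.

(* [banach_lattice le W V]: with the norm of the ambient space and the order
   [le], [W] is a (real or complex) Banach lattice with real part [V]. *)
Definition banach_lattice (R : realType) (k : scalar_kind) :
    forall E : completeNormedModType (scalars R k),
      (E -> E -> Prop) -> set E -> set E -> Prop :=
  match k with
  | RealScalars => fun E le W V => real_banach_lattice le V /\ W = V
  | ComplexScalars => fun E le W V =>
      real_banach_lattice le V /\ complexification le W V
  end.

(* [lattice_subspace le V F]: [F] is a lattice subspace of the ambient Banach
   lattice, whose real part is [V]. *)
Definition lattice_subspace (R : realType) (k : scalar_kind) :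
    forall E : completeNormedModType (scalars R k),
      (E -> E -> Prop) -> set E -> set E -> Prop :=
  match k with
  | RealScalars => fun E le V F =>
      linear_subspace F /\ vector_lattice le (F `&` V)
  | ComplexScalars => fun E le V F =>
      [/\ linear_subspace F, conjugation_invariant V F &
          vector_lattice le (F `&` V)]
  end.

(* Main.v *)
Require Import Defs.
From HB Require Import structures.
From mathcomp Require Import all_boot all_order all_algebra.
From mathcomp Require Import all_classical all_reals all_analysis.
From mathcomp Require Import complex.
Import Order.TTheory GRing.Theory Num.Theory.
Import numFieldNormedType.Exports.
Local Open Scope classical_set_scope.
Local Open Scope ring_scope.

(* If [g >= 0] satisfies [g <= T_i g] for all [i], Zorn's lemma yields a least
   fixed point [m] above [g], of the same norm as [g]: iterating the [T_i] and
   taking suprema of chains never leaves the set of [h] with [g <= h <= T_i h],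
   [|h| <= |g|] and [h] below every fixed point above [g]. For [G] a set of fixed
   vectors, [g = sup_E G] is such a vector whenever it is positive, and [m] is then
   the supremum of [G] in the fixed space; the general case follows by translating
   by an element of [G]. Parts (a), (b) and (c) are consequences of (d). *)

(** * Ordered vector spaces and suprema relative to a subspace *)

Section OrderedSpace.
Set Implicit Arguments.
Unset Strict Implicit.
Context {K : numFieldType} {E : completeNormedModType K}.
Variables (le : E -> E -> Prop) (V : set E).
Hypothesis V_ordered : ordered_vector_space le V.
Implicit Types (x y z : E) (A : set E).

Lemma ordered_space0 : V 0.
Proof. by case: V_ordered => -[]. Qed.

Lemma ordered_spaceD {x y} : V x -> V y -> V (x + y).
Proof. by case: V_ordered => -[_ VD _] _ _ _; exact: VD. Qed.

Lemma ordered_spaceN {x} : V x -> V (- x).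
Proof.
case: V_ordered => -[_ _ VZ] _ _ _ Vx; rewrite -scaleN1r.
by apply: VZ => //; rewrite rpredN.
Qed.

Lemma ordered_spaceB {x y} : V x -> V y -> V (x - y).
Proof. by move=> Vx Vy; apply: ordered_spaceD => //; exact: ordered_spaceN. Qed.

Lemma ole_refl {x} : V x -> le x x.
Proof. by case: V_ordered => _ [refl_ _ _] _ _; exact: refl_. Qed.

Lemma ole_anti {x y} : V x -> V y -> le x y -> le y x -> x = y.
Proof. by case: V_ordered => _ [_ anti _] _ _; exact: anti. Qed.

Lemma ole_trans {y x z} : V x -> V y -> V z -> le x y -> le y z -> le x z.
Proof. by case: V_ordered => _ [_ _ trans] _ _; exact: trans. Qed.

Lemma ole_addr {x y z} : V x -> V y -> V z -> le (x + z) (y + z) <-> le x y.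
Proof.
case: V_ordered => _ _ addr _ Vx Vy Vz; split; last exact: addr.
move=> /(addr _ _ _ (ordered_spaceD Vx Vz) (ordered_spaceD Vy Vz) (ordered_spaceN Vz)).
by rewrite !addrK.
Qed.

Lemma ole_subr0 {x y} : V x -> V y -> le 0 (y - x) <-> le x y.
Proof.
move=> Vx Vy; rewrite -(ole_addr ordered_space0 (ordered_spaceB Vy Vx) Vx).
by rewrite add0r subrK.
Qed.

Lemma ole_opp {x y} : V x -> V y -> le (- y) (- x) <-> le x y.
Proof.
move=> Vx Vy; rewrite -(ole_subr0 (ordered_spaceN Vy) (ordered_spaceN Vx)).
by rewrite opprK addrC ole_subr0.
Qed.

Lemma ole_scale {a : K} {x y} : 0 <= a -> V x -> V y -> le x y ->
  le (a *: x) (a *: y).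
Proof. by case: V_ordered => _ _ _ scale; exact: scale. Qed.

(** Adding [x] to both sides gives [0 <= 2 x], and scaling by [2^-1] preserves the order. *)
Lemma ole_half {x} : V x -> le (- x) x -> le 0 x.
Proof.
move=> Vx /(ole_addr (ordered_spaceN Vx) Vx Vx).2; rewrite addNr -mulr2n -scaler_nat => h.
have V2 : V (2 *: x) by rewrite scaler_nat mulr2n; exact: ordered_spaceD.
have /(ole_scale (a := 2^-1) _ ordered_space0 V2) : le 0 (2 *: x) by [].
by rewrite scaler0 scalerA mulVf ?pnatr_eq0// scale1r invr_ge0 ler0n; exact.
Qed.

Lemma sup_in_unique A s t : is_sup_in le V A s -> is_sup_in le V A t -> s = t.
Proof.
by move=> [Vs As sA] [Vt At tA]; apply: ole_anti; rewrite //; [apply: sA|apply: tA].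
Qed.

Lemma sup_in_translate A f s : A `<=` V -> V f ->
  is_sup_in le V A s -> is_sup_in le V ((fun x => x + f) @` A) (s + f).
Proof.
move=> AV Vf [Vs As sA]; split; first exact: ordered_spaceD.
  by move=> _ [x Ax <-]; apply/ole_addr => //; [exact: AV|exact: As].
move=> u Vu Au; have Vuf := ordered_spaceB Vu Vf.
rewrite -(subrK f u); apply/ole_addr => //; apply: sA => // x Ax.
by rewrite -(ole_addr (AV _ Ax) Vuf Vf) subrK; apply: Au; exists x.
Qed.

Lemma sup_in_translateN A f s : A `<=` V -> V f ->
  is_sup_in le V ((fun x => x - f) @` A) s -> is_sup_in le V A (s + f).
Proof.
move=> AV Vf sA; have -> : A = (fun x => x + f) @` ((fun x => x - f) @` A).
  rewrite image_comp -[LHS]image_id; apply: eq_imagel => x _ /=.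
  by rewrite subrK.
apply: sup_in_translate => // _ [x Ax <-].
by apply: ordered_spaceB => //; exact: AV.
Qed.

(** Every vector of [V] bounds the empty set, so [s] is the least element of [V]; comparing it with
    [s + s] gives the claim. *)
Lemma sup_in_set0_ge0 s : is_sup_in le V set0 s -> le 0 s.
Proof.
move=> [Vs _ s0]; rewrite -(addrK s s) (ole_subr0 Vs (ordered_spaceD Vs Vs)).
by apply: s0 => //; exact: ordered_spaceD.
Qed.

End OrderedSpace.

(** * Moduli, monotonicity of the norm and Dedekind completeness *)

Section BanachLattice.
Set Implicit Arguments.
Unset Strict Implicit.
Context {K : numFieldType} {E : completeNormedModType K}.
Variables (le : E -> E -> Prop) (V : set E).
Hypothesis V_banach : real_banach_lattice le V.
Implicit Types x y u : E.

Lemma banach_ordered : ordered_vector_space le V.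
Proof. by case: V_banach => -[]. Qed.
Let V_ordered := banach_ordered.

Lemma sup_in_pair_exists {x y} : V x -> V y ->
  exists s, is_sup_in le V [set x; y] s.
Proof. by case: V_banach => -[_ sup2 _] _ _; exact: sup2. Qed.

Lemma abs_in_pos u : V u -> le 0 u -> is_abs_in le V u u.
Proof.
move=> Vu u0; split => //; last by move=> v _; apply; left.
move=> _ [->|->]; first exact: (ole_refl V_ordered).
have V0 := ordered_space0 V_ordered.
apply: (ole_trans V_ordered _ V0) => //; first exact: (ordered_spaceN V_ordered).
by rewrite -oppr0; apply/(ole_opp V_ordered).
Qed.

(** The two bounds give [- u <= x <= u], hence [- u <= u]. This shows that real and complex moduli
    are positive. *)
Lemma pos_of_ubound_pm x u : V x -> V u -> le x u -> le (- x) u -> le 0 u.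
Proof.
move=> Vx Vu xu nxu; apply: (ole_half V_ordered) => //.
apply: (ole_trans V_ordered (y := x)) => //; first exact: (ordered_spaceN V_ordered).
rewrite -[x]opprK; apply/(ole_opp V_ordered) => //.
exact: (ordered_spaceN V_ordered).
Qed.

Lemma abs_in_ge0 x u : V x -> is_abs_in le V x u -> le 0 u.
Proof.
by move=> Vx [Vu xu _]; apply: (pos_of_ubound_pm Vx Vu); apply: xu; [left|right].
Qed.

(** Since [u] is positive, it is its own modulus; thus [x] and [u] share a modulus, and the lattice
    norm inequality applies in both directions. *)
Lemma norm_abs_in x u : V x -> is_abs_in le V x u -> `|u| = `|x|.
Proof.
move=> Vx xu; have Vu : V u by case: xu.
have uu := abs_in_pos Vu (abs_in_ge0 Vx xu).
have le_uu := ole_refl V_ordered Vu.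
have [_ normV _] := V_banach.
by apply/eqP; rewrite eq_le (normV u x u u) ?(normV x u u u).
Qed.

Lemma le_norm_pos x y : V x -> V y -> le 0 x -> le x y -> `|x| <= `|y|.
Proof.
move=> Vx Vy x0 xy; have [_ normV _] := V_banach.
apply: (normV x y x y) => //; apply: abs_in_pos => //.
exact: (ole_trans V_ordered (ordered_space0 V_ordered) Vx Vy).
Qed.

(* The elements above a given point of [A] and below every upper bound of [A]
   form an upward directed set with the same supremum as [A]. *)
Lemma monotonically_complete_dedekind :
  monotonically_complete le V -> dedekind_complete le V.
Proof.
move=> Vmc A AV [a Aa] _ [b Vb Ab]; have Va := AV _ Aa.
pose J := {x | [/\ V x, le a x & forall u, V u -> is_ubound le A u -> le x u]}.
have JV (j : J) : V (sval j) by case: (svalP j).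
pose leJ (i j : J) := le (sval i) (sval j).
(* Monotone completeness concerns nets of positive vectors, hence the shift by [a]. *)
pose x (j : J) := sval j - a.
have Vna := ordered_spaceN V_ordered Va.
have sub_a y : V y -> V (y - a) by move=> Vy; exact: (ordered_spaceB V_ordered).
have x_pos j : positive_cone le V (x j).
  split; first exact: sub_a.
  by apply/(ole_subr0 V_ordered) => //; case: (svalP j).
have join_J (i : J) (y : E) : V y -> (forall u, V u -> is_ubound le A u -> le y u) ->
    exists k : J, le (sval i) (sval k) /\ le y (sval k).
  move=> Vy Ay; have [s [Vs ijs sij]] := sup_in_pair_exists (JV i) Vy.
  have [Vi ai Ai] := svalP i.
  have is_ : le (sval i) s by apply: ijs; left.
  have Js : [/\ V s, le a s & forall u, V u -> is_ubound le A u -> le s u].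
    split=> //; first exact: (ole_trans V_ordered Va Vi Vs).
    by move=> u Vu Au; apply: sij => // _ [->|->]; [exact: Ai|exact: Ay].
  by exists (exist _ s Js); split=> //; apply: ijs; right.
have Ja : [/\ V a, le a a & forall u, V u -> is_ubound le A u -> le a u].
  by split=> //; [exact: (ole_refl V_ordered)|move=> u _; exact].
have x_incr : increasing_net le leJ x.
  split; last by move=> i j ij; apply/(ole_addr V_ordered).
  split; first by constructor; exists a.
  - by move=> i; exact: (ole_refl V_ordered).
  - by move=> i j k; exact: (ole_trans V_ordered).
  - by move=> i j; apply: join_J => //; case: (svalP j).
have x_bounded : exists M : K, forall j, `|x j| <= M.
  exists `|b - a| => j; have [Vxj xj0] := x_pos j.
  apply: le_norm_pos => //; first exact: sub_a.
  by apply/(ole_addr V_ordered) => //; case: (svalP j) => _ _; apply.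
have [s] := Vmc J leJ x x_incr x_pos x_bounded.
have -> : range x = (fun y => y - a) @` range (fun j : J => sval j).
  by rewrite image_comp.
have JsubV : range (fun j : J => sval j) `<=` V by move=> _ [j _ <-].
move=> /(sup_in_translateN V_ordered JsubV Va) [Vs Js sJ].
exists (s + a); split=> // [c Ac|u Vu Au].
  have [k [_ ck]] := join_J (exist _ a Ja) c (AV _ Ac) (fun u _ Au => Au c Ac).
  by apply: (ole_trans V_ordered _ (JV k) Vs ck); [exact: AV|apply: Js; exists k].
by apply: sJ => // _ [j _ <-]; case: (svalP j) => _ _; apply.
Qed.

End BanachLattice.

(** * The fixed space of commuting positive contractions *)

Section FixedSpace.
Set Implicit Arguments.
Unset Strict Implicit.
Context {K : numFieldType} {E : completeNormedModType K}.
Variables (le : E -> E -> Prop) (V : set E).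
Hypothesis V_banach : real_banach_lattice le V.
Hypothesis V_moncomplete : monotonically_complete le V.
Hypothesis V_fatou : fatou_property le V.
Variables (I : Type) (T : I -> {linear E -> E}).
Hypothesis T_pos : forall i, positive_operator le V (T i).
Hypothesis T_contr : forall i, contractive (T i).
Hypothesis T_comm : forall i j x, T i (T j x) = T j (T i x).
Implicit Types x y u : E.

Let V_ordered := banach_ordered V_banach.
Let F : set E := fixed_space (fun i => T i : E -> E).
Let Fre : set E := F `&` V.

Lemma fixed_space_linear : linear_subspace F.
Proof.
split=> [i|x y Fx Fy i|a x Fx i]; first exact: linear0.
  by rewrite linearD Fx Fy.
by rewrite linearZ /= Fx.
Qed.

Lemma contractive_continuous (f : {linear E -> E}) : contractive f -> continuous f.
Proof.
move=> f_contr; apply: bounded_linear_continuous; apply/linear_boundedP.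
exists 1; split=> // r r1 x; apply: le_trans (f_contr x) _.
by rewrite ler_peMl// ltW.
Qed.

Lemma fixed_space_closed : closed F.
Proof.
(* [F] is an intersection of kernels of the continuous maps [T i - id]. *)
have -> : F = \bigcap_(i in [set: I]) ((fun x : E => T i x - x) @^-1` [set (0 : E)]).
  apply/seteqP; split=> [x Fx i _|x Fx i]; first by rewrite /= Fx subrr.
  by apply/eqP; rewrite -subr_eq0; apply/eqP; exact: (Fx i).
apply: closed_bigI => i _; apply: preimage_closed; last first.
  by apply: accessible_closed_set1; apply: hausdorff_accessible; exact: norm_hausdorff.
move=> x _; apply: cvgB; last exact: cvg_id.
exact: (contractive_continuous (T_contr i)).
Qed.

(** Positivity constrains [T i] on the cone alone, so [x] is written as [s - (s - x)] with [s] the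
    supremum of [x] and [0], a difference of two positive vectors. *)
Lemma positive_operator_real i x : V x -> V (T i x).
Proof.
move=> Vx; have [s [Vs xs _]] := sup_in_pair_exists V_banach Vx (ordered_space0 V_ordered).
have [Ts _] : positive_cone le V (T i s).
  by apply: T_pos; split=> //; apply: xs; right.
have [Tsx _] : positive_cone le V (T i (s - x)).
  apply: T_pos; split; first exact: (ordered_spaceB V_ordered).
  by apply/(ole_subr0 V_ordered) => //; apply: xs; left.
by rewrite -(subKr s x) linearB; exact: (ordered_spaceB V_ordered).
Qed.

Lemma positive_operator_mono i x y : V x -> V y -> le x y -> le (T i x) (T i y).
Proof.
move=> Vx Vy /(ole_subr0 V_ordered Vx Vy) xy.
apply/(ole_subr0 V_ordered (positive_operator_real i Vx) (positive_operator_real i Vy)).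
rewrite -linearB; suff [] : positive_cone le V (T i (y - x)) by [].
by apply: T_pos; split=> //; exact: (ordered_spaceB V_ordered).
Qed.

Lemma fixed_real_ordered : ordered_vector_space le Fre.
Proof.
have [[V0 VD VZ] [Vr Va Vt] Vadd Vsc] := V_ordered.
have [F0 FD FZ] := fixed_space_linear.
split.
- split; first by split.
    by move=> x y [? ?] [? ?]; split; [exact: FD|exact: VD].
  by move=> a x ar [? ?]; split; [exact: FZ|exact: VZ].
- split.
  + by move=> x [_]; exact: Vr.
  + by move=> x y [_ ?] [_ ?]; exact: Va.
  + by move=> x y z [_ ?] [_ ?] [_ ?]; exact: Vt.
- by move=> x y z [_ ?] [_ ?] [_ ?]; exact: Vadd.
- by move=> a x y a0 [_ ?] [_ ?]; exact: Vsc.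
Qed.
Let Fre_ordered := fixed_real_ordered.

(* In the set [A] of the proof, chains have suprema by monotone completeness, and
   these keep the norm bound by the Fatou property. A maximal element [m] is fixed
   since [T i m >= m] is again in [A]; commutativity gives [T i m <= T j (T i m)]. *)
Lemma least_fixed_above g : V g -> le 0 g -> (forall i, le g (T i g)) ->
  exists m, [/\ Fre m, le g m, `|m| = `|g| &
                forall u, Fre u -> le g u -> le m u].
Proof.
move=> Vg g0 gT; have V0 := ordered_space0 V_ordered.
have tr := @ole_trans _ _ _ _ V_ordered.
pose A := [set h | [/\ V h, le g h, forall i, le h (T i h), `|h| <= `|g| &
                       forall u, Fre u -> le g u -> le h u]].
have Ag : A g by split=> //; exact: (ole_refl V_ordered).
pose X := {h | A h}.
have XV (h : X) : V (sval h) by case: (svalP h).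
have XA (h : X) : le g (sval h) by case: (svalP h).
have [|||C Ctot|m m_max] := @Zorn X (fun h h' => `[< le (sval h) (sval h') >]).
- by move=> h; apply/asboolP; exact: (ole_refl V_ordered).
- by move=> r s t /asboolP rs /asboolP st; apply/asboolP; exact: tr rs st.
- move=> [s As] [t At] /asboolP /= st /asboolP /= ts; apply: eq_exist.
  by apply: (ole_anti V_ordered _ _ st ts); [case: As|case: At].
(* Directed index sets are inhabited, so the empty chain is treated apart, with [g] as its bound. *)
- have [->|/set0P [c0 Cc0]] := eqVneq C set0; first by exists (exist _ g Ag).
  pose J := {h : X | C h}.
  pose x (j : J) : E := sval (sval j).
  pose leJ (i j : J) := le (x i) (x j).
  have xV j : V (x j) by exact: XV.
  have x_incr : increasing_net le leJ x.
    split=> //; split; first by constructor; exists c0.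
    + by move=> j; exact: (ole_refl V_ordered).
    + by move=> i j k; exact: tr.
    + move=> i j; have [/asboolP ij|/asboolP ji] := Ctot _ _ (svalP i) (svalP j).
        by exists j; split=> //; exact: (ole_refl V_ordered).
      by exists i; split=> //; exact: (ole_refl V_ordered).
  have x_pos j : positive_cone le V (x j).
    by split=> //; apply: tr g0 _ => //; exact: XA.
  have x_norm j : `|x j| <= `|g| by case: (svalP (sval j)).
  have [s xs] := V_moncomplete x_incr x_pos (ex_intro _ _ x_norm).
  have [_ s_norm] := V_fatou x_incr x_pos xs.
  have [Vs x_le_s s_least] := xs.
  have As : A s.
    split=> //.
    + by apply: (tr (x (exist _ c0 Cc0))) => //; [exact: XA|apply: x_le_s; eexists].
    + move=> i; apply: s_least; first exact: positive_operator_real.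
      move=> _ [j _ <-]; apply: (tr (T i (x j))) => //.
      * exact: positive_operator_real.
      * exact: positive_operator_real.
      * by case: (svalP (sval j)).
      * by apply: positive_operator_mono => //; apply: x_le_s; exists j.
    + by apply: s_norm => _ [j _ <-].
    + move=> u Fu gu; apply: s_least; first by case: Fu.
      by move=> _ [j _ <-]; case: (svalP (sval j)) => _ _ _ _; apply.
  exists (exist _ s As) => h Ch; apply/asboolP; apply: x_le_s.
  by exists (exist _ h Ch).
have [Vm gm mT m_norm m_least] := svalP m; exists (sval m).
have Fm : F (sval m).
  move=> i; have VTm := positive_operator_real i Vm.
  have ATm : A (T i (sval m)).
    split=> //; first exact: tr gm (mT i).
    - move=> j; rewrite T_comm; apply: positive_operator_mono => //.
      exact: positive_operator_real.
    - exact: le_trans (T_contr i _) m_norm.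
    - move=> u Fu gu; have [Fiu Vu] := Fu; rewrite -(Fiu i).
      by apply: positive_operator_mono => //; exact: m_least.
  by have /(congr1 sval) := m_max (exist _ _ ATm) (asboolT (mT i)).
split=> //; apply/eqP; rewrite eq_le m_norm /=.
exact: (le_norm_pos V_banach).
Qed.

Lemma fixed_sup_above_sup (G : set E) (gE : E) :
  G `<=` Fre -> is_sup_in le V G gE ->
  exists gF, [/\ is_sup_in le Fre G gF, le gE gF & le 0 gE -> `|gF| = `|gE|].
Proof.
have pos_case (G' : set E) g : G' `<=` Fre -> is_sup_in le V G' g -> le 0 g ->
    exists gF, [/\ is_sup_in le Fre G' gF, le g gF & `|gF| = `|g|].
  move=> GF [Vg Gg g_least] g0.
  (* Each [x] in [G'] satisfies [x = T i x <= T i g], so [T i g] is an upper bound of [G']. *)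
  have gT i : le g (T i g).
    apply: g_least; first exact: positive_operator_real.
    move=> x Gx; have [Fx Vx] := GF _ Gx; rewrite -(Fx i).
    by apply: positive_operator_mono => //; exact: Gg.
  have [m [Fm gm m_norm m_least]] := least_fixed_above Vg g0 gT.
  exists m; split=> //; split=> // [x Gx|u Fu Gu].
    have [_ Vx] := GF _ Gx; have [_ Vm] := Fm.
    exact: (ole_trans V_ordered Vx Vg Vm (Gg _ Gx) gm).
  by apply: m_least => //; apply: g_least => //; case: Fu.
move=> GF GgE; have [g0|g0] := pselect (le 0 gE).
  by have [m [? ? ?]] := pos_case _ _ GF GgE g0; exists m.
(* An empty [G] would make [gE] positive, against [g0]. Otherwise some [f] in [G] exists, and
   [G - f] has the positive supremum [gE - f]. *)
have [G0|/set0P [f Gf]] := eqVneq G set0.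
  by rewrite G0 in GgE; case: g0; exact: (sup_in_set0_ge0 V_ordered GgE).
have [Ff Vf] := GF _ Gf; have [VgE GlegE _] := GgE.
have Fref := GF _ Gf; have Fnf := ordered_spaceN Fre_ordered Fref.
have GV : G `<=` V by move=> x /GF[].
have GfF : (fun x => x - f) @` G `<=` Fre.
  by move=> _ [x Gx <-]; apply: (ordered_spaceD Fre_ordered) => //; exact: GF.
have GfgE := sup_in_translate V_ordered GV Fnf.2 GgE.
have [|m [Gm gm _]] := pos_case _ _ GfF GfgE.
  by apply/(ole_subr0 V_ordered) => //; exact: GlegE.
exists (m + f); split=> //; first exact: (sup_in_translateN Fre_ordered GF Fref Gm).
have Vm : V m by case: Gm => -[].
rewrite -(subrK f gE); apply/(ole_addr V_ordered) => //.
exact: (ordered_spaceB V_ordered).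
Qed.

(** Suprema of pairs in [E] are carried over to [Fre]; infima are negatives of suprema of the
    opposite vectors. *)
Lemma fixed_real_vector_lattice : vector_lattice le Fre.
Proof.
have sup2 x y : Fre x -> Fre y -> exists s, is_sup_in le Fre [set x; y] s.
  move=> Fx Fy; have [s xys] := sup_in_pair_exists V_banach Fx.2 Fy.2.
  have [|t [xyt _ _]] := fixed_sup_above_sup _ xys; last by exists t.
  by move=> _ [->|->].
split=> // x y Fx Fy.
have FN := fun z => @ordered_spaceN _ _ _ _ Fre_ordered z.
have [s [Fs xys s_least]] := sup2 _ _ (FN _ Fx) (FN _ Fy).
exists (- s); split; first exact: FN.
  move=> _ [->|->]; rewrite -[X in le _ X]opprK; apply/(ole_opp Fre_ordered) => //;
  by [exact: FN|apply: xys; by [left|right]].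
move=> l Fl lxy; rewrite -[l]opprK; apply/(ole_opp Fre_ordered) => //; first exact: FN.
apply: s_least; first exact: FN.
by move=> _ [->|->]; apply/(ole_opp Fre_ordered) => //; apply: lxy; [left|right].
Qed.

Lemma fixed_real_banach_lattice : real_banach_lattice le Fre.
Proof.
split; first exact: fixed_real_vector_lattice.
  (* The modulus of [x] in [Fre] may exceed its modulus [w] in [E], but as [w] is positive both have
     the norm of [x]. The lattice norm property then reduces to monotonicity of the norm on the cone
     of [V]. *)
  have norm_abs x u : Fre x -> is_abs_in le Fre x u ->
      [/\ V u, le 0 u & `|u| = `|x|].
    move=> Fx xu; have [Fu _ _] := xu; have Vx := Fx.2.
    have [w xw] := sup_in_pair_exists V_banach Vx (ordered_spaceN V_ordered Vx).
    have w0 := abs_in_ge0 V_banach Vx xw.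
    have [|t [xt wt t_norm]] := fixed_sup_above_sup _ xw.
      by move=> _ [->|->] //; exact: (ordered_spaceN Fre_ordered).
    rewrite (sup_in_unique Fre_ordered xu xt) (t_norm w0) (norm_abs_in V_banach Vx xw).
    have [Ft _ _] := xt; split=> //; first exact: Ft.2.
    have [Vw _ _] := xw.
    exact: (ole_trans V_ordered (ordered_space0 V_ordered) Vw Ft.2).
  move=> x y u v Fx Fy /(norm_abs _ _ Fx)[Vu u0 <-] /(norm_abs _ _ Fy)[Vv v0 <-].
  exact: (le_norm_pos V_banach).
(* Limits exist in [V], and closedness of [F] puts them in [Fre]. *)
have [_ _ V_complete] := V_banach.
move=> P PP PFre Pc.
have [|l Vl Pl] := V_complete P PP _ Pc; first by apply: filterS PFre => x [].
exists l => //; split=> //; apply: fixed_space_closed => B /Pl PB.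
by have [x [[Fx _] Bx]] := filter_ex (filterI PFre PB); exists x.
Qed.

Lemma fixed_real_monotonically_complete : monotonically_complete le Fre.
Proof.
move=> J leJ x x_incr x_pos x_bounded.
have [|s xs] := V_moncomplete x_incr _ x_bounded.
  by move=> j; have [[]] := x_pos j.
have [|t [xt _ _]] := fixed_sup_above_sup _ xs; last by exists t.
by move=> _ [j _ <-]; case: (x_pos j).
Qed.

(** The supremum [s] in [Fre] bounds the net in norm, so the net also has a supremum [w] in [E]. The
    supremum in [Fre] built from [w] has the norm of [w] and equals [s] by uniqueness, so the Fatou
    property of [E] at [w] suffices. *)
Lemma fixed_real_fatou : fatou_property le Fre.
Proof.
move=> J leJ x s x_incr x_pos [Fs xs s_least].
have x_posV j : positive_cone le V (x j) by have [[]] := x_pos j.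
have [|w xw] := V_moncomplete x_incr x_posV.
  exists `|s| => j; have [Vxj xj0] := x_posV j.
  by apply: (le_norm_pos V_banach) => //; [exact: Fs.2|apply: xs; exists j].
have xF : range x `<=` Fre by move=> _ [j _ <-]; case: (x_pos j).
have [t [xt wt t_norm]] := fixed_sup_above_sup xF xw.
(* The index set is inhabited, so [w] dominates some positive vector. *)
have w0 : le 0 w.
  have [[[j] _ _ _] _] := x_incr; have [Vxj xj0] := x_posV j; have [Vw xjw _] := xw.
  by apply: (ole_trans V_ordered (ordered_space0 V_ordered) Vxj Vw xj0); apply: xjw; exists j.
have -> : s = t by apply: (sup_in_unique Fre_ordered) xt.
by rewrite (t_norm w0); exact: (V_fatou x_incr).
Qed.

End FixedSpace.

(** * Complex scalars: conjugation and the complexification norm *)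

Section ComplexFixedSpace.
Set Implicit Arguments.
Unset Strict Implicit.
Context {R : realType} {E : completeNormedModType R[i]}.
Variables (le : E -> E -> Prop) (V : set E).
Hypothesis V_banach : real_banach_lattice le V.
Hypothesis V_complex : complexification le [set: E] V.
Hypothesis V_moncomplete : monotonically_complete le V.
Hypothesis V_fatou : fatou_property le V.
Variables (I : Type) (T : I -> {linear E -> E}).
Hypothesis T_pos : forall i, positive_operator le V (T i).
Hypothesis T_contr : forall i, contractive (T i).
Hypothesis T_comm : forall i j x, T i (T j x) = T j (T i x).

Let V_ordered := banach_ordered V_banach.
Let F : set E := fixed_space (fun i => T i : E -> E).
Let Fre : set E := F `&` V.

(** Each [T i] preserves [V], so [T i x - x] and [T i y - y] are the real and imaginary parts of
    zero, and the sum of [V] and [iV] is direct. *)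
Lemma fixed_complex_parts x y : V x -> V y -> F (x + 'i%C *: y) -> F x /\ F y.
Proof.
move=> Vx Vy Fxy; have [_ direct _] := V_complex.
suff parts i : T i x - x = 0 /\ T i y - y = 0.
  by split=> i; apply/eqP; rewrite -subr_eq0; apply/eqP; have [] := parts i.
have TV z : V z -> V (T i z) := @positive_operator_real _ _ _ _ V_banach _ _ T_pos i z.
apply: direct; [by apply: (ordered_spaceB V_ordered) => //; exact: TV..|].
by rewrite scalerBr addrACA -opprD -linearZ -linearD Fxy subrr.
Qed.

Lemma fixed_conjugation_invariant : conjugation_invariant V F.
Proof.
move=> x y Vx Vy /(fixed_complex_parts Vx Vy)[Fx Fy] i.
by rewrite linearB linearZ /= Fx Fy.
Qed.

Lemma fixed_complexification : complexification le F Fre.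
Proof.
have [V_all direct modulus] := V_complex.
have [_ FD FZ] := fixed_space_linear T.
split.
- apply/seteqP; split=> [z Fz|_ [x [Fx _]] [y [Fy _]] <-]; last by apply: FD => //; exact: FZ.
  have : [set: E] z by [].
  rewrite V_all => -[x Vx [y Vy xyz]].
  have [|Fx Fy] := @fixed_complex_parts x y Vx Vy; first by rewrite xyz.
  by exists x => //; exists y.
- by move=> x y [_ Vx] [_ Vy]; exact: direct.
move=> x y Fx Fy; have [m xym ->] := modulus x y Fx.2 Fy.2.
have Fre_ordered := fixed_real_ordered V_banach T.
have [[_ FreD FreZ] _ _ _] := Fre_ordered.
(* The vectors defining the modulus are real combinations of [x] and [y], hence lie in [Fre]; their
   supremum [n] there is the modulus in [F], with the norm of [m] once [m] is positive. *)
have [|n [xyn _ n_norm]] := fixed_sup_above_sup V_banach V_moncomplete V_fatou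
    T_pos T_contr T_comm _ xym.
  move=> _ [t _ <-]; apply: FreD; apply: FreZ => //; by apply/complex_realP; eexists.
exists n => //; rewrite n_norm //.
have [Vm xy_le_m _] := xym; have Vx := Fx.2.
have pi0 := pi_gt0 R.
(* The angles [0] and [pi] give [x] and [- x], both below [m]. *)
apply: (pos_of_ubound_pm V_banach Vx Vm).
- apply: xy_le_m; exists 0; first by rewrite /= lexx mulr_gt0.
  by rewrite cos0 sin0 scale1r scale0r addr0.
- apply: xy_le_m; exists pi; first by rewrite /= ltW //= mulr_natl mulr2n ltrDl.
  by rewrite cospi sinpi scale0r addr0 raddfN/= scaleN1r.
Qed.

End ComplexFixedSpace.

(** * Real and complex scalars together *)

Theorem theorem3p1 (R : realType) (k : scalar_kind)
    (E : completeNormedModType (scalars R k))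
    (le : E -> E -> Prop) (Ere : set E)
    (E_banach : banach_lattice le [set: E] Ere)
    (E_moncomplete : monotonically_complete le Ere)
    (E_fatou : fatou_property le Ere)
    (I : Type) (T : I -> {linear E -> E})
    (T_pos : forall i, positive_operator le Ere (T i))
    (T_contr : forall i, contractive (T i))
    (T_comm : forall i j x, T i (T j x) = T j (T i x)) :
  let F : set E := fixed_space (fun i => T i : E -> E) in
  let Fre : set E := F `&` Ere in
  [/\ linear_subspace F /\ closed F,
      lattice_subspace le Ere F,
      banach_lattice le F Fre,
      [/\ monotonically_complete le Fre, fatou_property le Fre &
          dedekind_complete le Fre] &
      forall (G : set E) (gE : E), G `<=` Fre -> is_sup_in le Ere G gE ->
        exists gF : E, [/\ is_sup_in le Fre G gF, le gE gF &
                           le 0 gE -> `|gF| = `|gE|]].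
Proof.
(* The type of [E] depends on [k], so all that depends on [E] is generalized before the case split;
   the facts about the real part are then derived alike in both cases. *)
case: k E le Ere E_banach E_moncomplete E_fatou T T_pos T_contr T_comm
    => E le Ere [V_banach E_complex] mc fatou T pos contr comm F Fre;
  have F_linear := fixed_space_linear T;
  have F_closed := fixed_space_closed contr;
  have F_lattice := fixed_real_vector_lattice V_banach mc fatou pos contr comm;
  have F_banach := fixed_real_banach_lattice V_banach mc fatou pos contr comm;
  have F_mc := fixed_real_monotonically_complete V_banach mc fatou pos contr comm;
  have F_fatou := fixed_real_fatou V_banach mc fatou pos contr comm;
  have F_dedekind := monotonically_complete_dedekind F_banach F_mc;
  have F_sup := fixed_sup_above_sup V_banach mc fatou pos contr comm.
- split=> //; split=> //.
  (* For real scalars [Ere] is the whole space, so [F] is its own real part. *)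
  by rewrite /Fre -E_complex setIT.
- split=> //; split=> //.
    exact: (fixed_conjugation_invariant V_banach E_complex pos).
  exact: (fixed_complexification V_banach E_complex mc fatou pos contr comm).
Qed.
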